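(* Let $K$ be a field of characteristic zero, let $k\geq 1$ be an integer, and let $R$ be a $K$-algebra which is Lie nilpotent of index $k$. If $e\in K$ is a primitive $n$-th root of unity and $\delta\in\mathrm{Aut}_K(R)$ is a $K$-automorphism with $\delta^n=\mathrm{id}_R$, then the skew polynomial algebra $R[w,\delta]$ is right integral of degree $n^k$ over the $K$-subalgebra $\mathrm{Fix}(\delta)[w^n]$ of $R[w,\delta]$. In other words, for any $f(w)\in R[w,\delta]$ we have $$g_0(w^n)+f(w)g_1(w^n)+\cdots+f^{n^k-1}(w)g_{n^k-1}(w^n)+f^{n^k}(w)=0$$ for some $g_i(w^n)\in\mathrm{Fix}(\delta)[w^n]$, $0\leq i\leq n^k-1$ (here $w^n$ is central in $R[w,\delta]$).
   Context: Algebras are unitary, associative and not necessarily commutative; $K$-automorphisms are $K$-algebra automorphisms (preserving the identity). With $[x,y]=xy-yx$, a ring $R$ is called Lie nilpotent of index $k$ if $[[\ldots[[x_1,x_2],x_3],\ldots,x_k],x_{k+1}]=0$ for all $x_1,\ldots,x_{k+1}\in R$. $\mathrm{Fix}(\delta)=\{r\in R\mid\delta(r)=r\}$. The skew polynomial algebra $R[w,\delta]$ consists of the left polynomials $r_0+r_1w+\cdots+r_tw^t$ with $r_i\in R$, with the obvious addition and the multiplication determined by $wr=\delta(r)w$ for $r\in R$. $\mathrm{Fix}(\delta)[w^n]$ is the set of elements $c_0+c_1w^n+\cdots+c_dw^{nd}$ of $R[w,\delta]$ with $c_0,\ldots,c_d\in\mathrm{Fix}(\delta)$. $f^i(w)$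 denotes the $i$-th power of $f(w)$ in $R[w,\delta]$. *)

(* Defs.v *)
From HB Require Import structures.
From mathcomp Require Import all_boot all_order all_algebra.

Set Implicit Arguments.
Unset Strict Implicit.
Unset Printing Implicit Defensive.

Import GRing.Theory.
Local Open Scope ring_scope.

Definition lie_comm (R : pzRingType) (x y : R) : R := x * y - y * x.

(* [[...[[x_1, x_2], x_3], ...], x_(k+1)] = 0 for all x_1, ..., x_(k+1); the
   tuple s lists x_2, ..., x_(k+1). *)
Definition lie_nilpotent (R : pzRingType) (k : nat) : Prop :=
  forall (x : R) (s : k.-tuple R), foldl (@lie_comm R) x s = 0.

Definition fixed_elements (T : eqType) (delta : T -> T) : {pred T} :=
  [pred r | delta r == r].

(* A left polynomial r_0 + r_1 w + ... + r_t w^t is encoded by its sequence of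
   left coefficients, as in {poly R}; only the product is different. *)
Definition skewpoly (K : comNzRingType) (R : algType K)
  (delta : {lrmorphism R -> R}) : Type := {poly R}.

Section SkewPoly.

Variables (K : comNzRingType) (R : algType K) (delta : {lrmorphism R -> R}).

Local Notation S := (skewpoly delta).

HB.instance Definition _ := GRing.Zmodule.copy S {poly R}.

Implicit Types (p q : {poly R}) (a : K).

Fact iter_is_zmod i : zmod_morphism (iter i delta).
Proof. by elim: i => // i IH x y /=; rewrite IH rmorphB. Qed.

HB.instance Definition _ i :=
  GRing.isZmodMorphism.Build R R (iter i delta) (iter_is_zmod i).

Fact iter_is_monoid i : monoid_morphism (iter i delta).
Proof.
split; first by elim: i => //= i ->; rewrite rmorph1.
by elim: i => // i IH x y /=; rewrite IH rmorphM.
Qed.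

HB.instance Definition _ i :=
  GRing.isMonoidMorphism.Build R R (iter i delta) (iter_is_monoid i).

Fact iter_is_scalable i : scalable (iter i delta).
Proof. by elim: i => // i IH a x /=; rewrite IH linearZ. Qed.

HB.instance Definition _ i :=
  GRing.isScalable.Build K R R *:%R (iter i delta) (iter_is_scalable i).

(* Bilinear extension of (r w^i) (s w^j) = r delta^i(s) w^(i + j). *)
Definition skew_mul p q : {poly R} :=
  \poly_(m < (size p + size q).-1)
     (\sum_(i < m.+1) p`_i * iter i delta q`_(m - i)).

Lemma coef_skew_mul p q m :
  (skew_mul p q)`_m = \sum_(i < m.+1) p`_i * iter i delta q`_(m - i).
Proof.
rewrite coef_poly ltn_predRL; case: leqP => // le_pq_m1.
rewrite big1 // => j _; have [lq_p_j|lt_j_p] := leqP (size p) j.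
  by rewrite nth_default ?mul0r.
rewrite [q`__]nth_default ?raddf0 ?mulr0 // leq_subRL -ltnS //.
by rewrite (leq_trans _ le_pq_m1) // ltn_add2r.
Qed.

Lemma coef_skew_mul_rev p q m :
  (skew_mul p q)`_m = \sum_(i < m.+1) p`_(m - i) * iter (m - i) delta q`_i.
Proof.
rewrite coef_skew_mul (reindex_inj rev_ord_inj) /=.
by apply: eq_bigr => j _; rewrite subSS (sub_ordK j).
Qed.

Fact skew_mulA : associative skew_mul.
Proof.
move=> p q r; apply/polyP=> i; rewrite coef_skew_mul coef_skew_mul_rev.
pose coef3 j k := p`_j * (iter j delta q`_(i - j - k)
                          * iter (i - k) delta r`_k).
transitivity (\sum_(j < i.+1) \sum_(k < i.+1 | (k <= i - j)%N) coef3 j k).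
  apply: eq_bigr => /= j _; rewrite coef_skew_mul_rev raddf_sum big_distrr /=.
  rewrite (big_ord_narrow_leq (leq_subr _ _)); apply: eq_bigr => k _ /=.
  rewrite rmorphM /= -iterD /coef3; congr (_ * (_ * iter _ _ _)).
  by rewrite addnBA ?leq_ord // subnKC // -ltnS.
rewrite (exchange_big_dep predT) //=; apply: eq_bigr => k _.
transitivity (\sum_(j < i.+1 | (j <= i - k)%N) coef3 j k).
  apply: eq_bigl => j; rewrite -ltnS -(ltnS j) -!subSn ?leq_ord //.
  by rewrite -subn_gt0 -(subn_gt0 j) -!subnDA addnC.
rewrite (big_ord_narrow_leq (leq_subr _ _)) coef_skew_mul big_distrl /=.
by apply: eq_bigr => j _; rewrite /coef3 -!subnDA addnC mulrA.
Qed.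

Fact skew_mul1l : left_id 1%:P skew_mul.
Proof.
move=> p; apply/polyP => i; rewrite coef_skew_mul big_ord_recl subn0.
by rewrite big1 => [|j _]; rewrite coefC /= ?mul1r ?addr0 ?mul0r.
Qed.

Fact skew_mul1r : right_id 1%:P skew_mul.
Proof.
move=> p; apply/polyP => i; rewrite coef_skew_mul_rev big_ord_recl subn0.
rewrite big1 => [|j _]; rewrite coefC /= ?rmorph1 ?mulr1 ?addr0 //.
by rewrite raddf0 mulr0.
Qed.

Fact skew_mulDl : left_distributive skew_mul +%R.
Proof.
move=> p q r; apply/polyP=> i; rewrite coefD !coef_skew_mul -big_split.
by apply: eq_bigr => j _; rewrite coefD mulrDl.
Qed.

Fact skew_mulDr : right_distributive skew_mul +%R.
Proof.
move=> p q r; apply/polyP=> i; rewrite coefD !coef_skew_mul -big_split.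
by apply: eq_bigr => j _; rewrite coefD raddfD mulrDr.
Qed.

Fact skew_1_neq0 : (1%:P : {poly R}) != 0.
Proof. by rewrite polyC_eq0 oner_neq0. Qed.

HB.instance Definition _ := GRing.Zmodule_isNzRing.Build S
  skew_mulA skew_mul1l skew_mul1r skew_mulDl skew_mulDr skew_1_neq0.

Definition skew_scale a p : {poly R} := a%:A *: p.

Lemma coef_skew_scale a p i : (skew_scale a p)`_i = a *: p`_i.
Proof. by rewrite coefZ mulr_algl. Qed.

Fact skew_scaleA a b p : skew_scale a (skew_scale b p) = skew_scale (a * b) p.
Proof. by apply/polyP=> i; rewrite !coef_skew_scale scalerA. Qed.

Fact skew_scale1 : left_id 1 skew_scale.
Proof. by move=> p; apply/polyP=> i; rewrite coef_skew_scale scale1r. Qed.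

Fact skew_scaleDr : right_distributive skew_scale +%R.
Proof. by move=> a p q; rewrite /skew_scale scalerDr. Qed.

Fact skew_scaleDl p : {morph skew_scale^~ p : a b / a + b}.
Proof. by move=> a b; rewrite /skew_scale !scalerDl. Qed.

HB.instance Definition _ := GRing.Zmodule_isLmodule.Build K S
  skew_scaleA skew_scale1 skew_scaleDr skew_scaleDl.

Fact skew_scaleAl a (p q : S) : a *: (p * q) = (a *: p) * q.
Proof.
apply/polyP=> i; rewrite coef_skew_scale !coef_skew_mul scaler_sumr.
by apply: eq_bigr => j _; rewrite coef_skew_scale scalerAl.
Qed.

HB.instance Definition _ := GRing.Lmodule_isLalgebra.Build K S skew_scaleAl.

Fact skew_scaleAr a (p q : S) : a *: (p * q) = p * (a *: q).
Proof.
apply/polyP=> i; rewrite coef_skew_scale !coef_skew_mul scaler_sumr.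
by apply: eq_bigr => j _; rewrite coef_skew_scale linearZ scalerAr.
Qed.

HB.instance Definition _ := GRing.Lalgebra_isAlgebra.Build K S skew_scaleAr.

Definition skew_coef (f : S) (i : nat) : R := (f : {poly R})`_i.

Definition skewC (r : R) : S := r%:P.

Definition skewX : S := ('X : {poly R}).

Lemma skew_coefP (f g : S) : skew_coef f =1 skew_coef g <-> f = g.
Proof. by split=> [fg | -> //]; apply/polyP. Qed.

Lemma skew_coefD (f g : S) i :
  skew_coef (f + g) i = skew_coef f i + skew_coef g i.
Proof. exact: coefD. Qed.

Lemma skew_coef_sum (I : Type) (r : seq I) (P : pred I) (F : I -> S) i :
  skew_coef (\sum_(j <- r | P j) F j) i
  = \sum_(j <- r | P j) skew_coef (F j) i.
Proof. exact: coef_sum. Qed.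

Lemma skew_coefZ a (f : S) i : skew_coef (a *: f) i = a *: skew_coef f i.
Proof. exact: coef_skew_scale. Qed.

Lemma skew_coefM (f g : S) m :
  skew_coef (f * g) m =
  \sum_(i < m.+1) skew_coef f i * iter i delta (skew_coef g (m - i)).
Proof. exact: coef_skew_mul. Qed.

Lemma skew_coefC r i : skew_coef (skewC r) i = if i == 0%N then r else 0.
Proof. exact: coefC. Qed.

Lemma skew_coefX i : skew_coef skewX i = (i == 1%N)%:R.
Proof. exact: coefX. Qed.

Lemma skewX_skewC r : skewX * skewC r = skewC (delta r) * skewX.
Proof.
apply/skew_coefP => i; rewrite !skew_coefM !big_ord_recl !skew_coefX.
rewrite !skew_coefC subn0 mul0r add0r [X in _ = _ + X]big1 ?addr0; last first.
  by move=> j _; rewrite skew_coefC mul0r.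
case: i => [|i]; first by rewrite big_ord0 mulr0.
rewrite big_ord_recl big1 ?addr0 => [|j _]; last by rewrite skew_coefX mul0r.
rewrite skew_coefX skew_coefC /= subSS subn0 mul1r.
by case: i => [|i] /=; rewrite ?mulr1 // raddf0 mulr0.
Qed.

Lemma skew_coefCXn r i j :
  skew_coef (skewC r * skewX ^+ i) j = if j == i then r else 0.
Proof.
elim: i j => [|m IH] l; first by rewrite expr0 mulr1 skew_coefC.
rewrite exprSr mulrA skew_coefM; case: l => [|l].
  by rewrite big_ord1 skew_coefX raddf0 mulr0.
rewrite big_ord_recr /= subnn skew_coefX !raddf0 mulr0 addr0.
rewrite big_ord_recr /= subSn // subnn skew_coefX rmorph1 mulr1.
rewrite big1 => [|h _]; first by rewrite add0r IH eqSS.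
rewrite skew_coefX subSn ?(ltnW (ltn_ord h)) // eqSS subn_eq0 leqNgt ltn_ord.
by rewrite raddf0 mulr0.
Qed.

Lemma skewpoly_expand (f : S) :
  f = \sum_(i < size (f : {poly R})) skewC (skew_coef f i) * skewX ^+ i.
Proof.
apply/skew_coefP => j; rewrite skew_coef_sum.
under eq_bigr do rewrite skew_coefCXn.
have [lt_j | le_j] := ltnP j (size (f : {poly R})).
  rewrite (bigD1 (Ordinal lt_j)) //= eqxx big1 ?addr0 // => i.
  by rewrite -val_eqE /= eq_sym => /negPf ->.
rewrite big1 => [|i _]; first by rewrite /skew_coef nth_default.
by case: eqP => // ji; move: (ltn_ord i); rewrite -ji ltnNge le_j.
Qed.

(* Fix(delta)[w^n]; see fix_skewpolyP for the expanded form of its elements. *)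
Definition fix_skewpoly (n : nat) : {pred S} :=
  [pred f : S | [forall i : 'I_(size (f : {poly R})),
     (skew_coef f i \in fixed_elements delta) && ((n %| i)%N || (skew_coef f i == 0))]].

Lemma fix_skewpoly_coefP n (f : S) :
  reflect (forall i, delta (skew_coef f i) = skew_coef f i
                     /\ (~~ (n %| i)%N -> skew_coef f i = 0))
          (f \in fix_skewpoly n).
Proof.
apply: (iffP forallP) => [fP i | fP i].
  have [lt_i | le_i] := ltnP i (size (f : {poly R})).
    have /andP[/eqP fi /orP[-> // | /eqP ->]] := fP (Ordinal lt_i).
    by rewrite raddf0.
  by rewrite /skew_coef nth_default // raddf0.
have [fi n_i] := fP i; rewrite inE fi eqxx /=.
by case: (boolP (n %| i)%N) => // /n_i ->; rewrite eqxx.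
Qed.

Lemma fix_skewpolyP n (f : S) : (0 < n)%N ->
  f \in fix_skewpoly n <->
  exists (d : nat) (c : 'I_d.+1 -> R),
    (forall i, c i \in fixed_elements delta) /\
    f = \sum_(i < d.+1) skewC (c i) * skewX ^+ (n * i).
Proof.
move=> n_gt0; split=> [/fix_skewpoly_coefP fP | [d [c [cP ->]]]].
  exists (size (f : {poly R})), (fun i => skew_coef f (n * i)%N).
  split=> [i|]; first by rewrite inE; apply/eqP; case: (fP (n * i)%N).
  apply/skew_coefP => j; rewrite skew_coef_sum.
  under eq_bigr do rewrite skew_coefCXn.
  have [/dvdnP[q ->] | n_j] := boolP (n %| j)%N; last first.
    rewrite big1 => [|i _]; first by case: (fP j) => _ ->.
    by case: eqP => // ji; rewrite ji dvdn_mulr in n_j.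
  rewrite mulnC; have [lt_q | le_q] := ltnP q (size (f : {poly R})).+1.
    rewrite (bigD1 (Ordinal lt_q)) //= eqxx big1 ?addr0 // => i.
    by rewrite -val_eqE /= eqn_pmul2l // eq_sym => /negPf ->.
  rewrite big1 => [|i _].
    by rewrite /skew_coef nth_default // (leq_trans (ltnW le_q)) // leq_pmull.
  rewrite eqn_pmul2l //; case: eqP => // qi.
  by move: (ltn_ord i); rewrite -qi ltnNge le_q.
apply/fix_skewpoly_coefP => j; rewrite skew_coef_sum.
under eq_bigr do rewrite skew_coefCXn.
split=> [|n_j]; last first.
  by rewrite big1 // => i _; case: eqP => // ji; rewrite ji dvdn_mulr in n_j.
rewrite raddf_sum; apply: eq_bigr => i _.
by case: eqP => _; rewrite ?raddf0 //; apply/eqP; apply: cP.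
Qed.

Fact fix_skewpoly_closed n : GRing.subsemialg_closed (fix_skewpoly n).
Proof.
split; [|split|..].
- apply/fix_skewpoly_coefP => i; rewrite (skew_coefC 1).
  by case: eqP => [-> | _]; rewrite ?rmorph1 ?dvdn0 ?raddf0.
- by apply/fix_skewpoly_coefP => i; rewrite /skew_coef coef0 raddf0.
- move=> f g /fix_skewpoly_coefP fP /fix_skewpoly_coefP gP.
  apply/fix_skewpoly_coefP => i; have [fi nf] := fP i; have [gi ng] := gP i.
  rewrite skew_coefD raddfD /= fi gi; split=> // n_i.
  by rewrite nf // ng // addr0.
- move=> a f /fix_skewpoly_coefP fP; apply/fix_skewpoly_coefP => i.
  have [fi nf] := fP i; rewrite skew_coefZ linearZ /= fi; split=> // n_i.
  by rewrite nf // scaler0.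
move=> f g /fix_skewpoly_coefP fP /fix_skewpoly_coefP gP.
have gfix m i : iter m delta (skew_coef g i) = skew_coef g i.
  by elim: m => //= m ->; case: (gP i).
apply/fix_skewpoly_coefP => i; rewrite skew_coefM; split=> [|n_i].
  rewrite raddf_sum; apply: eq_bigr => j _.
  by rewrite gfix [LHS]rmorphM /=; case: (fP j) => ->; case: (gP (i - j)%N) => ->.
apply: big1 => j _; rewrite gfix.
have [n_j | /(proj2 (fP j)) ->] := boolP (n %| j)%N; last by rewrite mul0r.
rewrite (proj2 (gP _)) ?mulr0 //; apply: contra n_i => n_ij.
by rewrite -(subnK (leq_ord j)) dvdn_add.
Qed.

HB.instance Definition _ n :=
  GRing.isSubalgClosed.Build K S (fix_skewpoly n) (fix_skewpoly_closed n).

End SkewPoly.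

Arguments skewX {K R} delta.
Arguments skewC {K R} delta r.
Arguments fix_skewpoly {K R} delta n.

(* Coefficients multiply on the right of the powers of f. *)
Definition right_integral_of_degree (K : comNzRingType) (A : algType K)
    (B : subalgClosed A) (m : nat) : Prop :=
  forall f : A, exists g : 'I_m -> A,
    (forall i, g i \in B) /\ \sum_(i < m) f ^+ i * g i + f ^+ m = 0.

(* Main.v *)
From Stdlib Require Import Ncring Ncring_tac.
From HB Require Import structures.
Require Import Defs.
From mathcomp Require Import all_boot all_order all_fingroup all_algebra.

(** Right multiplication by [f] on the left [R[z]]-basis 1, w, ..., w^(n-1) of
    [R[w, delta]], where [z = w^n], is a matrix [A] over [R[z]]. Symmetrising the
    adjoint over all orders of its factors gives [B = X - A |-> B *m symadj B],
    which modulo additive commutators is scalar: a symmetrised word may be rotated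
    cyclically, so the usual argument for the adjugate applies. Hence the entries of
    [B *m symadj B] lie in the subring generated by one element, the commutators and
    the center, and Latyshev's lemma L_m L_n \subset R L_(m + n - 2) shows that the
    Lie nilpotency index of that subring is one less. After [k] rounds the matrix
    [(X - A) *m P] is scalar, equal to a polynomial in [X] of degree n^k whose
    leading coefficient is a positive integer, and the usual telescoping argument
    makes [A] a root of it. Conjugation by the matrix of [w] acts on these matrices
    as [delta] and commutes with [symadj], so the coefficients are fixed by [delta]. *)

Set Implicit Arguments.
Unset Strict Implicit.
Unset Printing Implicit Defensive.

Import GRing.Theory.
Local Open Scope ring_scope.

(** * Ring structure behind [non_commutative_ring], which checks the commutator identities *)

Instance mc_ring_ops (R : pzRingType) :
  @Ring_ops R 0 1 +%R *%R (fun x y => x - y) -%R eq := {}.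

Instance mc_ring (R : pzRingType) : Ring (Ro := mc_ring_ops R).
Proof.
constructor; try typeclasses eauto; try by move=> *; subst.
- exact: add0r.
- exact: addrC.
- exact: addrA.
- exact: mul1r.
- exact: mulr1.
- exact: mulrA.
- exact: mulrDl.
- by move=> x y z; exact: mulrDr.
- exact: subrr.
Qed.

(** * Lower central series of a subring and the ideals it generates *)

Section LowerCentralSeries.

Variable R : pzRingType.
Implicit Types (x y z u v c : R) (S T : R -> Prop).

Local Notation "{[ x , y ]}" := (lie_comm x y).

Definition central c := forall x, c * x = x * c.

Lemma central_nat m : central m%:R.
Proof. by move=> x; rewrite mulr_natl mulr_natr. Qed.

Lemma centralN1 : central (-1).
Proof. by move=> x; rewrite mulN1r mulrN1. Qed.

Lemma central_inv c (d : R) : central c -> c * d = 1 -> central d.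
Proof.
move=> cC cd1 x; have dc1 : d * c = 1 by rewrite -cC.
by rewrite -[LHS]mulr1 -{1}cd1 mulrA -[d * x * c]mulrA -cC mulrA dc1 mul1r.
Qed.

(** These are the subrings containing the center of the whole ring [R]: 0, 1 and negation come from
    central elements. All spans below take coefficients in that same center, so they stay compatible
    when [T] changes. *)
Record overcenter T : Prop := Overcenter {
  overZ : forall c, central c -> T c;
  overD : forall x y, T x -> T y -> T (x + y);
  overM : forall x y, T x -> T y -> T (x * y) }.

Inductive cspan S : R -> Prop :=
  | cspan_gen x : S x -> cspan S x
  | cspan0 : cspan S 0
  | cspanD x y : cspan S x -> cspan S y -> cspan S (x + y)
  | cspanZ c x : central c -> cspan S x -> cspan S (c * x).

Lemma cspanN S x : cspan S x -> cspan S (- x).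
Proof. by rewrite -mulN1r; apply: cspanZ; apply: centralN1. Qed.

Lemma cspanB S x y : cspan S x -> cspan S y -> cspan S (x - y).
Proof. by move=> Sx Sy; apply/cspanD/cspanN. Qed.

Lemma cspan_sum S (I : Type) (r : seq I) (P : pred I) (F : I -> R) :
  (forall i, P i -> cspan S (F i)) -> cspan S (\sum_(i <- r | P i) F i).
Proof. by move=> SF; elim/big_ind: _ => //; [exact: cspan0|exact: cspanD]. Qed.

Lemma cspan_cancel_nat S x m (d : R) :
  (m%:R : R) * d = 1 -> cspan S (x *+ m) -> cspan S x.
Proof.
move=> md1 Sx; have dC := central_inv (@central_nat m) md1.
have -> : x = d * (x *+ m) by rewrite mulrnAr -mulrnAl -[d *+ m]mulr_natl md1 mul1r.
exact: cspanZ.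
Qed.

(* Indices are shifted: [lcs T i] is the usual L_(i + 1), so [lcs T 0 = T]. *)
Fixpoint lcs T i : R -> Prop :=
  if i is j.+1 then
    cspan (fun x => exists a b, [/\ lcs T j a, T b & x = {[a, b]}])
  else T.

Definition lcs_ideal T i : R -> Prop :=
  cspan (fun x => exists a b, [/\ T a, lcs T i b & x = a * b]).

Section Overcenter.

Variables (T : R -> Prop) (Tz : overcenter T).

Local Notation L := (lcs T).
Local Notation M := (lcs_ideal T).

Lemma overN x : T x -> T (- x).
Proof.
by rewrite -mulN1r; apply: (overM Tz); apply: (overZ Tz); apply: centralN1.
Qed.

Lemma over1 : T 1.
Proof. by apply: (overZ Tz) => x; rewrite mul1r mulr1. Qed.

Lemma over_lie x y : T x -> T y -> T {[x, y]}.
Proof. by move=> Tx Ty; apply: (overD Tz); [|apply: overN]; apply: (overM Tz). Qed.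

Lemma lcs0 i : L i 0.
Proof. 
case: i => [|i]; last exact: cspan0.
by apply: (overZ Tz) => x; rewrite mul0r mulr0.
Qed.

Lemma lcsD i x y : L i x -> L i y -> L i (x + y).
Proof. by case: i => [|i]; [apply: (overD Tz)|apply: cspanD]. Qed.

Lemma lcsZ i c x : central c -> L i x -> L i (c * x).
Proof.
case: i => [|i] cC Lx; last exact: cspanZ.
by apply: (overM Tz) => //; apply: (overZ Tz).
Qed.

Lemma lcsN i x : L i x -> L i (- x).
Proof. by rewrite -mulN1r; apply: lcsZ; apply: centralN1. Qed.

Lemma lcsB i x y : L i x -> L i y -> L i (x - y).
Proof. by move=> Lx Ly; apply: lcsD => //; apply: lcsN. Qed.

Lemma lcs_lie i x y : L i x -> T y -> L i.+1 {[x, y]}.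
Proof. by move=> Lx Ty; apply: cspan_gen; exists x, y. Qed.

Lemma lieC x y : {[x, y]} = - {[y, x]}.
Proof. by rewrite /lie_comm opprB. Qed.

Lemma lieDr x y z : {[x, y + z]} = {[x, y]} + {[x, z]}.
Proof. by rewrite /lie_comm; non_commutative_ring. Qed.

Lemma lieDl x y z : {[x + y, z]} = {[x, z]} + {[y, z]}.
Proof. by rewrite /lie_comm; non_commutative_ring. Qed.

Lemma lieZr c x y : central c -> {[x, c * y]} = c * {[x, y]}.
Proof. by move=> cC; rewrite /lie_comm mulrA -cC -!mulrA -mulrBr. Qed.

Lemma lieZl c x y : central c -> {[c * x, y]} = c * {[x, y]}.
Proof. by move=> cC; rewrite lieC lieZr // -mulrN -lieC. Qed.

Lemma lie0r x : {[x, 0]} = 0.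
Proof. by rewrite /lie_comm mulr0 mul0r subrr. Qed.

Lemma lie0l x : {[0, x]} = 0.
Proof. by rewrite /lie_comm mulr0 mul0r subrr. Qed.

Lemma lcs_prev i x : L i.+1 x -> L i x.
Proof.
elim: i x => [|i IH] x /=; elim=> {x} [x [a [b [La Tb ->]]]| |x y _ Lx _ Ly|c x cC _ Lx].
- exact: over_lie.
- exact: (lcs0 0).
- exact: (overD Tz).
- by apply: (overM Tz) => //; apply: (overZ Tz).
- by apply: lcs_lie => //; apply: IH.
- exact: cspan0.
- exact: cspanD.
- exact: cspanZ.
Qed.

Lemma lcs_over i x : L i x -> T x.
Proof. by elim: i x => // i IH x /lcs_prev /IH. Qed.

(** Induction on [j], where the Jacobi identity moves one bracket out of the second argument. With
    unshifted indices this is the usual [L_m, L_n] \subset L_(m + n). *)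
Lemma lie_lcs i j x y : L i x -> L j y -> L (i + j).+1 {[x, y]}.
Proof.
elim: j i x y => [|j IH] i x y Lx; first by rewrite addn0; apply: lcs_lie.
elim=> {y} [y [a [b [La Tb ->]]]| |y z _ Ly _ Lz|c y cC _ Ly].
- have -> : {[x, {[a, b]}]} = {[{[x, a]}, b]} - {[{[x, b]}, a]}.
    by rewrite /lie_comm; non_commutative_ring.
  rewrite addnS; apply: lcsB; first by apply: lcs_lie => //; apply: IH.
  by rewrite -addSn; apply: IH => //; apply: lcs_lie.
- by rewrite lie0r; apply: lcs0.
- by rewrite lieDr; apply: lcsD.
- by rewrite lieZr //; apply: lcsZ.
Qed.

Lemma idealMl i x y : T x -> M i y -> M i (x * y).
Proof.
move=> Tx; elim=> {y} [y [a [b [Ta Lb ->]]]| |y z _ Ly _ Lz|c y cC _ Ly].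
- by apply: cspan_gen; exists (x * a), b; rewrite mulrA; split=> //; apply: (overM Tz).
- by rewrite mulr0; apply: cspan0.
- by rewrite mulrDr; apply: cspanD.
- by rewrite mulrA -cC -mulrA; apply: cspanZ.
Qed.

Lemma lcs_ideal_gen i x : L i x -> M i x.
Proof.
by move=> Lx; apply: cspan_gen; exists 1, x; rewrite mul1r; split=> //; exact: over1.
Qed.

Lemma ideal_prev i x : M i.+1 x -> M i x.
Proof.
elim=> {x} [x [a [b [Ta Lb ->]]]| |y z _ Ly _ Lz|c y cC _ Ly].
- by apply: idealMl => //; apply/lcs_ideal_gen/lcs_prev.
- exact: cspan0.
- exact: cspanD.
- exact: cspanZ.
Qed.

Lemma ideal_le (i j : nat) x : (j <= i)%N -> M i x -> M j x.
Proof. by move/subnK <-; elim: (i - j)%N => // m IH /ideal_prev. Qed.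

(** The left ideal is two-sided because b y = y b + [b, y], where the bracket lies one step further
    down the series. *)
Lemma idealMr i x y : M i x -> T y -> M i (x * y).
Proof.
move=> Mx Ty; elim: Mx => {x} [x [a [b [Ta Lb ->]]]| |x z _ Mx _ Mz|c x cC _ Mx].
- rewrite -mulrA; apply: idealMl => //.
  have -> : b * y = y * b + {[b, y]} by rewrite /lie_comm; non_commutative_ring.
  apply: cspanD; first by apply/idealMl/lcs_ideal_gen.
  by apply/ideal_prev/lcs_ideal_gen/lcs_lie.
- by rewrite mul0r; apply: cspan0.
- by rewrite mulrDl; apply: cspanD.
- by rewrite -mulrA; apply: cspanZ.
Qed.

Lemma ideal_lie i x y : M i x -> T y -> M i {[x, y]}.
Proof. by move=> Mx Ty; apply: cspanB; [apply: idealMr|apply: idealMl]. Qed.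

(* Expand [u, [v, x z]], which lies in L (i + j + 2). *)
Lemma lie_mul_swap i j u v x z : L i u -> L j v -> T x -> T z ->
  M (i + j).+2 ({[u, x]} * {[v, z]} + {[u, z]} * {[v, x]}).
Proof.
move=> Lu Lv Tx Tz'.
have -> : {[u, x]} * {[v, z]} + {[u, z]} * {[v, x]}
   = {[u, {[v, x * z]}]} - {[u, {[v, x]}]} * z - x * {[u, {[v, z]}]}
     + {[{[u, z]}, {[v, x]}]}.
  by rewrite /lie_comm; non_commutative_ring.
have LL w : T w -> M (i + j).+2 {[u, {[v, w]}]}.
  move=> Tw; apply: lcs_ideal_gen; rewrite -addnS.
  by apply: lie_lcs => //; apply: lcs_lie.
apply: cspanD; first apply: cspanB; first apply: cspanB.
- exact/LL/(overM Tz).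
- by apply: idealMr => //; apply: LL.
- by apply: idealMl => //; apply: LL.
apply: (@ideal_le (i + j).+3) => //; apply: lcs_ideal_gen.
by rewrite -addSn -addnS; apply: lie_lcs; apply: lcs_lie.
Qed.

(** * Products of terms of the lower central series *)

Section Latyshev.

Variables (half : R) (half2 : 2%:R * half = 1).

(* Latyshev's lemma, usually written L_m L_n \subset R L_(m + n - 2). With
   F x y z = [u, x] [[v, y], z] for [u \in L i], [v \in L j], modulo the ideal
   F is antisymmetric in (x, y) and in (x, z), hence in (y, z), whereas
   F x y z - F x z y = [u, x] [v, [y, z]] vanishes: so 2 F = 0. *)
Lemma lcs_mul i j x y : L i x -> L j y -> M (i + j - 1) (x * y).
Proof.
have [m] := ubnP j; elim: m => // m IHm in i j x y *.
(* For [j] equal to 0 or 1 the target contains [M i], so the first factor alone suffices. *)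
case: j => [|[|j]] lt_jm Lx Ly.
- apply: (@ideal_le i); first by rewrite addn0 subn1 leq_pred.
  by apply: idealMr => //; apply: lcs_ideal_gen.
- rewrite addn1 subn1; apply: idealMr; first exact: lcs_ideal_gen.
  exact: (lcs_prev (i := 0)).
rewrite !addnS subn1 /=.
elim: Ly => {y} [_ [v1 [z [Lv1 Tz1 ->]]]| |y z _ My _ Mz|c y cC _ My]; last 3 first.
- by rewrite mulr0; apply: cspan0.
- by rewrite mulrDr; apply: cspanD.
- by rewrite mulrA -cC -mulrA; apply: cspanZ.
elim: Lv1 => {v1} [_ [v [y [Lv Ty ->]]]| |y1 z1 _ My _ Mz|c y1 cC _ My]; last 3 first.
- by rewrite lie0l mulr0; apply: cspan0.
- by rewrite lieDl mulrDr; apply: cspanD.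
- by rewrite lieZl // mulrA -cC -mulrA; apply: cspanZ.
case: i Lx => [|i] Lx.
  apply: (@ideal_le j.+2) => //; apply: idealMl => //.
  by apply/lcs_ideal_gen/lcs_lie => //; apply: lcs_lie.
elim: Lx => {x} [_ [u [x [Lu Tx ->]]]| |x1 x2 _ M1 _ M2|c x1 cC _ M1]; last 3 first.
- by rewrite mul0r; apply: cspan0.
- by rewrite mulrDl; apply: cspanD.
- by rewrite -mulrA; apply: cspanZ.
rewrite addSn.
pose F x y z := {[u, x]} * {[{[v, y]}, z]}.
have swap2 x1 x2 x3 : T x1 -> T x2 -> T x3 ->
    M (i + j).+2 (F x1 x2 x3 + F x2 x1 x3).
  move=> T1 T2 T3.
  (* Leibniz rule for the bracket of the sum in [lie_mul_swap] with [x3]; two error terms remain. *)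
  have -> : F x1 x2 x3 + F x2 x1 x3 =
      {[ {[u, x1]} * {[v, x2]} + {[u, x2]} * {[v, x1]}, x3]}
      - {[{[u, x1]}, x3]} * {[v, x2]} - {[{[u, x2]}, x3]} * {[v, x1]}.
    by rewrite /F /lie_comm; non_commutative_ring.
  (* The error terms have the same total weight, but one bracket has moved to the left factor: the
     second index drops from [j.+2] to [j.+1], and the induction hypothesis applies. *)
  have IH w1 w2 : T w1 -> T w2 ->
      M (i + j).+2 ({[{[u, w1]}, x3]} * {[v, w2]}).
    move=> Tw1 Tw2; have := @IHm i.+2 j.+1 {[{[u, w1]}, x3]} {[v, w2]} lt_jm.
    rewrite addSnnS !addnS subn1; apply; last exact: lcs_lie.
    by apply: lcs_lie => //; apply: lcs_lie.
  apply: cspanB; first apply: cspanB; [|exact: IH|exact: IH].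
  by apply: ideal_lie => //; apply: lie_mul_swap.
have swap3 x1 x2 x3 : T x1 -> T x2 -> T x3 ->
    M (i + j).+2 (F x1 x2 x3 + F x3 x2 x1).
  move=> T1 T2 T3; apply: (@ideal_le (i + j.+1).+2); first by rewrite addnS.
  by apply: lie_mul_swap => //; apply: lcs_lie.
have jac : M (i + j).+2 (F x y z - F x z y).
  have -> : F x y z - F x z y =
      ({[u, x]} * {[v, {[y, z]}]} + {[u, {[y, z]}]} * {[v, x]})
      - {[u, {[y, z]}]} * {[v, x]}.
    by rewrite /F /lie_comm; non_commutative_ring.
  apply: cspanB; first by apply: lie_mul_swap => //; apply: over_lie.
  have := @IHm i.+2 j.+1 {[u, {[y, z]}]} {[v, x]} lt_jm.
  rewrite addSnnS !addnS subn1; apply; last exact: lcs_lie.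
  have := @lie_lcs i 1 u {[y, z]}; rewrite addn1; apply=> //.
  exact: (lcs_lie (i := 0)).
apply: (cspan_cancel_nat half2); rewrite -/(F x y z).
have -> : F x y z *+ 2 = (F x y z - F x z y)
    + ((F x y z + F y x z) - (F y x z + F z x y) + (F z x y + F x z y)).
  by rewrite mulr2n; non_commutative_ring.
apply: cspanD => //; apply: cspanD; last exact: swap2.
by apply: cspanB; [apply: swap2|apply: swap3].
Qed.

Lemma lcs_ideal_mul i j x y : M i x -> M j y -> M (i + j - 1) (x * y).
Proof.
move=> Mx; elim=> {y} [y [a [l [Ta Ll ->]]]| |y z _ My _ Mz|c y cC _ My].
- rewrite mulrA; elim: (idealMr Mx Ta) => {x a Mx Ta}
    [x [a [l1 [Ta Ll1 ->]]]| |x z _ Mx _ Mz|c x cC _ Mx].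
  + by rewrite -mulrA; apply: idealMl => //; apply: lcs_mul.
  + by rewrite mul0r; apply: cspan0.
  + by rewrite mulrDl; apply: cspanD.
  + by rewrite -mulrA; apply: cspanZ.
- by rewrite mulr0; apply: cspan0.
- by rewrite mulrDr; apply: cspanD.
- by rewrite mulrA -cC -mulrA; apply: cspanZ.
Qed.

(** * The subring generated by one element, the center and commutators *)

Section Descent.

Variable b : R.
Hypothesis Tb : T b.

(* [wfilt d] is spanned by the products of factors [b] and factors in L i.+1
   of weight i, of total weight at least d. *)
Inductive wfilt : nat -> R -> Prop :=
  | wfiltZ c : central c -> wfilt 0 c
  | wfilt_b : wfilt 0 b
  | wfilt_lcs i x : L i.+1 x -> wfilt i x
  | wfiltD d x y : wfilt d x -> wfilt d y -> wfilt d (x + y)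
  | wfiltM d d' x y : wfilt d x -> wfilt d' y -> wfilt (d + d') (x * y)
  | wfilt_prev d x : wfilt d.+1 x -> wfilt d x.

Lemma wfilt_scale d c x : central c -> wfilt d x -> wfilt d (c * x).
Proof. by move=> cC; apply: (wfiltM (d := 0)); apply: wfiltZ. Qed.

Lemma wfiltN d x : wfilt d x -> wfilt d (- x).
Proof. by rewrite -mulN1r; apply: wfilt_scale; apply: centralN1. Qed.

Lemma wfilt0 d : wfilt d 0.
Proof. by apply/wfilt_lcs/lcs0. Qed.

(** Every bracket gains a unit of weight. The Leibniz rule reduces this to generators: [b, b] = 0,
    which is why a single [b] is adjoined, a bracket with [b] goes one step down the series, and two
    commutator generators gain two units. *)
Lemma wfilt_lie d d' x y :
  wfilt d x -> wfilt d' y -> wfilt (d + d').+1 {[x, y]}.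
Proof.
move=> Wx Wy; elim: Wy d x Wx => {d' y} [c cC||j y Ly|d' y z _ IHy _ IHz
  |d1 d2 y z Wy IHy Wz IHz|d' y _ IHy] d x Wx.
- by rewrite /lie_comm -cC subrr; apply: wfilt0.
- rewrite addn0; elim: Wx => {d x} [c cC||i x Lx|d x y _ IHx _ IHy
    |d1 d2 x y Wx IHx Wy IHy|d x _ IHx].
  + by rewrite /lie_comm cC subrr; apply: wfilt0.
  + by rewrite /lie_comm subrr; apply: wfilt0.
  + by apply: wfilt_lcs; apply: lcs_lie.
  + by rewrite lieDl; apply: wfiltD.
  + have -> : {[x * y, b]} = x * {[y, b]} + {[x, b]} * y.
      by rewrite /lie_comm; non_commutative_ring.
    by apply: wfiltD; [rewrite -addnS|rewrite -addSn]; apply: wfiltM.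
  + exact: wfilt_prev.
- elim: Wx => {d x} [c cC||i x Lx|d x z _ IHx _ IHz
    |d1 d2 x z Wx IHx Wz IHz|d x _ IHx].
  + by rewrite /lie_comm cC subrr; apply: wfilt0.
  + rewrite lieC; apply: wfiltN; apply: wfilt_lcs; exact: lcs_lie.
  + apply/wfilt_prev/wfilt_lcs.
    by have := lie_lcs Lx Ly; rewrite !addnS !addSn.
  + by rewrite lieDl; apply: wfiltD.
  + have -> : {[x * z, y]} = x * {[z, y]} + {[x, y]} * z.
      by rewrite /lie_comm; non_commutative_ring.
    apply: wfiltD; first by rewrite -addnA -addnS; apply: wfiltM.
    by rewrite addnAC -addSn; apply: wfiltM.
  + by apply: wfilt_prev.
- by rewrite lieDr; apply: wfiltD; [apply: IHy|apply: IHz].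
- have -> : {[x, y * z]} = y * {[x, z]} + {[x, y]} * z.
    by rewrite /lie_comm; non_commutative_ring.
  apply: wfiltD; last by rewrite addnA -addSn; apply: wfiltM => //; apply: IHy.
  by rewrite addnCA -addnS; apply: wfiltM => //; apply: IHz.
- by apply: wfilt_prev; rewrite -addnS; apply: IHy.
Qed.

(** For a product of two factors of positive weight, Latyshev's lemma gives M (d1 + 1) M (d2 + 1)
    \subset M (d1 + d2 + 1), exactly the weight needed. Weight 0 is excluded since [b] need not lie
    in [M 1]. *)
Lemma wfilt_sub d x : wfilt d x -> T x /\ (0 < d -> M d.+1 x)%N.
Proof.
elim=> {d x} [c cC||i x Lx|d x y _ [Tx Mx] _ [Ty My]
  |d1 d2 x y _ [Tx Mx] _ [Ty My]|d x _ [Tx Mx]].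
- by split=> //; apply: (overZ Tz).
- by [].
- by split; [apply: (lcs_over Lx)|move=> _; apply: lcs_ideal_gen].
- split=> [|d_gt0]; first exact: (overD Tz).
  by apply: cspanD; [apply: Mx|apply: My].
- split; first exact: (overM Tz).
  case: d1 d2 Mx My => [|d1] [|d2] Mx My // _.
  + by apply: idealMl => //; apply: My.
  + by rewrite addn0; apply: idealMr => //; apply: Mx.
  + have := lcs_ideal_mul (Mx isT) (My isT).
    by rewrite !addnS !addSn subn1.
- by split=> // _; apply/ideal_prev/Mx.
Qed.

Lemma lcs_wfilt i x : lcs (wfilt 0) i x -> wfilt i x.
Proof.
elim: i x => //= i IH x; elim=> {x} [x [x1 [x2 [/IH W1 W2 ->]]]| |x y _ Wx _ Wy|c x cC _ Wx].
- by have := wfilt_lie W1 W2; rewrite addn0.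
- exact: wfilt0.
- exact: wfiltD.
- exact: wfilt_scale.
Qed.

Lemma wfilt_overcenter : overcenter (wfilt 0).
Proof.
by split; [exact: wfiltZ|exact: (@wfiltD 0)|exact: (@wfiltM 0 0)].
Qed.

(** The index drops by one: a (k + 1)-fold commutator in the new subring has weight k + 1, hence
    lies in [M k.+2], which is zero. *)
Lemma wfilt_nilpotent k : (forall x, L k.+2 x -> x = 0) ->
  forall x, lcs (wfilt 0) k.+1 x -> x = 0.
Proof.
move=> nilT x /lcs_wfilt /wfilt_sub [_ /(_ isT)].
elim=> {x} [x [a [l [Ta /nilT -> ->]]]| |x y _ -> _ ->|c x cC _ ->] //.
- by rewrite mulr0.
- by rewrite addr0.
- by rewrite mulr0.
Qed.

End Descent.
End Latyshev.
End Overcenter.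
End LowerCentralSeries.

(** * The symmetrised adjoint and its products modulo commutators *)

Section SymmetricAdjoint.

Variables (R : pzRingType) (n : nat).

Local Notation I := 'I_n.+1.
Implicit Types (A : 'M[R]_n.+1) (s t : 'S_n.+1) (i j l p q : I).

(** Here [t] lists the rows other than [l] in every order and [s] chooses the columns. Over a
    commutative ring this is n! times the adjugate. *)
Definition symadj A : 'M[R]_n.+1 :=
  \matrix_(j, l) \sum_(s : 'S_n.+1 | s l == j) \sum_(t : 'S_n.+1 | t ord0 == l)
    (-1) ^+ s * \prod_(q < n) A (t (lift ord0 q)) (s (t (lift ord0 q))).

Definition cyc : 'S_n.+1 := perm (can_inj (@ordSK n.+1)).

Lemma cyc_max : cyc ord_max = ord0.
Proof. by rewrite permE; apply: val_inj; rewrite /= modnn. Qed.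

Lemma cyc_widen (q : 'I_n) : cyc (widen_ord (leqnSn n) q) = lift ord0 q.
Proof. by rewrite permE; apply: val_inj; rewrite /= modn_small // ltnS. Qed.

(** One term of the determinant of [A] with row [l] replaced by row [i], its factors taken in the
    order [t]. In [symdet_at] the replaced row stands at position [p] of the word; [symdet] allows
    all positions. *)
Definition symword A i l s t :=
  \prod_(q < n.+1) A (if t q == l then i else t q) (s (t q)).

Definition symdet_at A i l p :=
  \sum_(s : 'S_n.+1) \sum_(t : 'S_n.+1 | t p == l)
    (-1) ^+ s * symword A i l s t.

Definition symdet A i l :=
  \sum_(s : 'S_n.+1) \sum_(t : 'S_n.+1) (-1) ^+ s * symword A i l s t.

Lemma mul_symadj A i l : (A *m symadj A) i l = symdet_at A i l ord0.
Proof.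
rewrite mxE /symdet_at (partition_big (fun s : 'S_n.+1 => s l) predT) //=.
apply: eq_bigr => j _; rewrite mxE big_distrr /=; apply: eq_bigr => s /eqP slj.
rewrite big_distrr /=; apply: eq_bigr => t /eqP t0l.
rewrite /symword big_ord_recl t0l eqxx slj !mulrA; congr (_ * _).
  by case: (odd_perm s); rewrite ?mul1r ?mulr1 // mulN1r mulrN1.
apply: eq_bigr => q _; rewrite -t0l (inj_eq perm_inj) eq_sym.
by rewrite (negPf (neq_lift _ _)).
Qed.

Lemma sum_symdet_at A i l : \sum_p symdet_at A i l p = symdet A i l.
Proof.
rewrite exchange_big; apply: eq_bigr => s _.
rewrite [RHS](partition_big (fun t : 'S_n.+1 => (t^-1)%g l) predT) //=.
apply: eq_bigr => p _; apply: eq_bigl => t.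
by rewrite /= -[RHS](inj_eq (@perm_inj _ t)) permKV eq_sym.
Qed.

(** Two rows are equal: composing both [s] and [t] with the transposition of [i] and [l] flips the
    sign and leaves each word unchanged, factor by factor. *)
Lemma symdet_off A i l : i != l -> symdet A i l = - symdet A i l.
Proof.
move=> il; rewrite {1}/symdet (reindex_inj (mulgI (tperm i l))) /= -sumrN.
apply: eq_bigr => s _; rewrite -sumrN (reindex_inj (mulIg (tperm i l))) /=.
apply: eq_bigr => t _.
rewrite odd_permM odd_tperm il addTb signrN mulNr; congr (- (_ * _)).
apply: eq_bigr => q _; rewrite !permM tpermK; congr (A _ _).
by case: tpermP => [->|->|//]; rewrite ?eqxx // (negPf il).
Qed.

Lemma symdet_diag A i l : symdet A i i = symdet A l l.
Proof.
apply: eq_bigr => s _; apply: eq_bigr => t _; congr (_ * _).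
by apply: eq_bigr => q _; case: eqP => [->|_]; case: eqP => [->|_].
Qed.

Section ModuloCommutators.

Variables (T : R -> Prop) (Tz : overcenter T).
Variables (A : 'M[R]_n.+1) (TA : forall i j, T (A i j)).

Lemma over_prod (m : nat) (v : 'I_m -> R) :
  (forall q : 'I_m, T (v q)) -> T (\prod_(q < m) v q).
Proof.
by move=> Tv; elim/big_ind: _ => //; [apply: over1|apply: (overM Tz)].
Qed.

Lemma prod_cyc (v : I -> R) : (forall q, T (v q)) ->
  lcs T 1 (\prod_q v q - \prod_q v (cyc q)).
Proof.
move=> Tv; rewrite big_ord_recl big_ord_recr /= cyc_max.
under [X in _ - X * _]eq_bigr do rewrite cyc_widen.
by apply: (lcs_lie (i := 0)) => //; apply: over_prod.
Qed.

Lemma sign_central (b : bool) : central ((-1) ^+ b : R).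
Proof. by case: b => x; rewrite ?mulN1r ?mulrN1 ?mul1r ?mulr1. Qed.

(** Replacing [t] by [cyc * t] moves the position of row [l] and rotates each word, at the cost of
    one commutator per word. *)
Lemma symdet_at_cyc i l p :
  lcs T 1 (symdet_at A i l p - symdet_at A i l (cyc p)).
Proof.
rewrite -sumrB; apply: cspan_sum => s _.
rewrite (reindex_inj (mulgI cyc)) /=.
under eq_bigl do rewrite permM.
rewrite -sumrB; apply: cspan_sum => t _; rewrite -mulrBr.
apply: cspanZ; first exact: sign_central.
rewrite -opprB; apply: cspanN.
pose v q := A (if t q == l then i else t q) (s (t q)).
have -> : symword A i l s (cyc * t) = \prod_q v (cyc q).
  by apply: eq_bigr => q _; rewrite permM.
by apply: prod_cyc => q; apply: TA.
Qed.

Lemma symdet_at0 i l p : lcs T 1 (symdet_at A i l ord0 - symdet_at A i l p).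
Proof.
case: p => m; elim: m => [|m IH] lt_m.
  by rewrite (_ : Ordinal _ = ord0) ?subrr; [apply: cspan0|apply: val_inj].
have -> : Ordinal lt_m = cyc (Ordinal (ltnW lt_m)).
  by rewrite permE; apply: val_inj; rewrite /= modn_small.
rewrite -(subrK (symdet_at A i l (Ordinal (ltnW lt_m))) (symdet_at A i l ord0)).
by rewrite -addrA; apply: cspanD; [apply: IH|apply: symdet_at_cyc].
Qed.

(** The entry is the part with row [l] first; modulo commutators all n + 1 positions give the same
    value, and together they sum to [symdet]. *)
Lemma mul_symadj_symdet i l :
  lcs T 1 ((A *m symadj A) i l *+ n.+1 - symdet A i l).
Proof.
rewrite -sum_symdet_at mul_symadj -[X in _ *+ X]card_ord -sumr_const -sumrB.
by apply: cspan_sum => p _; apply: symdet_at0.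
Qed.

Hypothesis natV : forall m, exists d : R, m.+1%:R * d = 1.

Lemma mul_symadj_off i l : i != l -> lcs T 1 ((A *m symadj A) i l).
Proof.
move=> il; have [d nd] := natV n; apply: (cspan_cancel_nat nd).
have E0 : symdet A i l = 0.
  have [h h2] := natV 1; rewrite -[LHS]mul1r -h2 (central_nat _ h) -mulrA.
  by rewrite mulr_natl mulr2n {2}symdet_off // subrr mulr0.
by have := mul_symadj_symdet i l; rewrite E0 subr0.
Qed.

Lemma mul_symadj_diag i l :
  lcs T 1 ((A *m symadj A) i i - (A *m symadj A) l l).
Proof.
have [d nd] := natV n; apply: (cspan_cancel_nat nd); rewrite mulrnBl.
rewrite -[X in X - _](subrK (symdet A i i)) -addrA {2}(symdet_diag A i l).
apply: cspanD; first exact: mul_symadj_symdet.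
by rewrite -opprB; apply/cspanN/mul_symadj_symdet.
Qed.

Lemma symadj_over i j : T (symadj A i j).
Proof.
rewrite mxE; elim/big_ind: _ => [||s _]; [exact: (lcs0 Tz 0)|exact: (overD Tz)|].
elim/big_ind: _ => [||t _]; [exact: (lcs0 Tz 0)|exact: (overD Tz)|].
apply: (overM Tz); last exact: over_prod.
exact/(overZ Tz)/sign_central.
Qed.

Lemma mul_symadj_over i j : T ((A *m symadj A) i j).
Proof.
rewrite mxE; elim/big_ind: _ => [||k _]; [exact: (lcs0 Tz 0)|exact: (overD Tz)|].
by apply: (overM Tz) => //; apply: symadj_over.
Qed.

End ModuloCommutators.

Definition adj_iter k A := iter k (fun B => B *m symadj B) A.

Lemma adj_iter_mul k A : exists P, adj_iter k A = A *m P.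
Proof.
elim: k => [|k [P /= ->]]; first by exists 1%:M; rewrite mulmx1.
by exists (P *m symadj (A *m P)); rewrite mulmxA.
Qed.

(** Induction on the nilpotency index. When [lcs T 1] vanishes one round gives a scalar matrix;
    otherwise one round puts the entries in a subring of smaller index. *)
Theorem adj_iter_scalar (natV : forall m, exists d : R, m.+1%:R * d = 1)
  k T A : overcenter T -> (forall x, lcs T k.+1 x -> x = 0) ->
  (forall i j, T (A i j)) -> exists c, adj_iter k.+1 A = c%:M.
Proof.
elim: k T A => [|k IH] T A Tz nilT TA.
  exists ((A *m symadj A) ord0 ord0); apply/matrixP => i l.
  rewrite [RHS]mxE; have [<-|il] := eqVneq i l.
    by apply/subr0_eq/nilT; apply: mul_symadj_diag.
  by apply/nilT; apply: mul_symadj_off.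
rewrite /adj_iter iterSr -/(adj_iter _ _).
pose b := (A *m symadj A) ord0 ord0.
have Tb : T b by apply: mul_symadj_over.
have [h h2] := natV 1.
have [] := IH (wfilt T b 0) (A *m symadj A); last by move=> c ->; exists c.
- exact: wfilt_overcenter.
- exact: (wfilt_nilpotent Tz h2 Tb nilT).
(* Diagonal entries differ from [b] by commutators, and off-diagonal ones are commutators. *)
move=> i l; have [<-|il] := eqVneq i l.
  rewrite -[X in wfilt _ _ _ X](subrK b); apply: wfiltD; last exact: wfilt_b.
  by apply: wfilt_lcs; apply: mul_symadj_diag.
by apply: wfilt_lcs; apply: mul_symadj_off.
Qed.

End SymmetricAdjoint.

(** * Compatibility with the twist by delta *)

Section Twist.

Variables (R : pzRingType) (n : nat) (D : {rmorphism R -> R}).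
Variables (Z : R) (Zcent : central Z) (Zreg : forall x, Z * x = 0 -> x = 0).

Local Notation I := 'I_n.+1.

Definition wraps (i : I) : nat := i == ord_max.

(* U A = D(A) U, where U is the cyclic shift with [Z] in the corner: the matrix
   of right multiplication by [w] when [Z = w^n]. *)
Definition twisted (A : 'M[R]_n.+1) := forall i j,
  Z ^+ wraps i * A (cyc n i) (cyc n j) = D (A i j) * Z ^+ wraps j.

Lemma central_exp m : central (Z ^+ m).
Proof. by move=> x; apply/esym/commrX/esym/Zcent. Qed.

(** Exactly one row wraps, so the rows other than [t ord0] contain it unless it is [t ord0]. *)
Lemma sum_wrap (t : 'S_n.+1) :
  (\sum_(q < n) wraps (t (lift ord0 q)) = 1 - wraps (t ord0))%N.
Proof.
have <- : (\sum_(i : I) wraps (t i) = 1)%N.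
  rewrite -(reindex_inj (@perm_inj _ t) (P := predT)) /=.
  rewrite (bigD1 ord_max) //= /wraps eqxx big1 ?addn0 // => i /negPf ->.
  by [].
by rewrite big_ord_recl addKn.
Qed.

Lemma prod_exp_l m (a : 'I_m -> nat) (v : 'I_m -> R) :
  Z ^+ (\sum_q a q) * \prod_q v q = \prod_q (Z ^+ a q * v q).
Proof.
elim: m a v => [|m IH] a v; first by rewrite !big_ord0 mulr1.
rewrite !big_ord_recl -IH exprD !mulrA; congr (_ * _).
by rewrite -!mulrA [_ * v _]central_exp.
Qed.

(** Conjugating [s] by [cyc] and shifting [t] matches the words at the shifted entry with those at
    (j, l), factor by factor. *)
Lemma twisted_symadj A : twisted A -> twisted (symadj A).
Proof.
move=> tA j l.
pose B := symadj A (cyc n j) (cyc n l).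
(* A word omits row [l] and column [j], so the powers of [Z] come out complemented. Multiplying by
   the missing powers leaves one surplus [Z] on each side, cancelled by regularity. *)
suff E : Z ^+ (1 - wraps l) * B = D (symadj A j l) * Z ^+ (1 - wraps j).
  have wle i : (wraps i <= 1)%N by rewrite /wraps; case: (_ == _).
  have := congr1 (fun x => Z ^+ (wraps j + wraps l) * x) E.
  rewrite !mulrA -exprD -addnA subnKC // addn1 exprS -mulrA => E1.
  apply/subr0_eq/Zreg; rewrite mulrBr {}E1 central_exp.
  rewrite -mulrA -exprD addnAC subnKC // add1n exprS.
  by rewrite mulrA -[_ * Z]Zcent -mulrA subrr.
rewrite /B !mxE rmorph_sum mulr_sumr mulr_suml /=.
pose conj (s : 'S_n.+1) := ((cyc n)^-1 * s * cyc n)%g.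
have conj_inj : injective conj by move=> s s' /mulIg /mulgI.
rewrite (reindex_inj conj_inj) /=.
apply: eq_big => s; first by rewrite /conj !permM permK (inj_eq perm_inj).
rewrite /conj !permM permK (inj_eq perm_inj) => /eqP slj.
pose mulc (t : 'S_n.+1) : 'S_n.+1 := (t * cyc n)%g.
have mul_inj : injective mulc by apply: mulIg.
rewrite mulr_sumr rmorph_sum mulr_suml (reindex_inj mul_inj) /=.
apply: eq_big => t; first by rewrite /mulc permM (inj_eq perm_inj).
rewrite /mulc permM (inj_eq perm_inj) => /eqP t0l.
rewrite !odd_permM odd_permV addbAC addbb addFb.
rewrite mulrA [Z ^+ _ * _]central_exp -mulrA rmorphM rmorph_sign -mulrA.
congr (_ * _); rewrite rmorph_prod -central_exp -t0l -sum_wrap.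
rewrite -slj -t0l -permM -sum_wrap !prod_exp_l; apply: eq_bigr => q _.
by rewrite !permM permK tA central_exp.
Qed.

Lemma twisted_mul A B : twisted A -> twisted B -> twisted (A *m B).
Proof.
move=> tA tB i l; rewrite !mxE (reindex_inj (@perm_inj _ (cyc n))) /=.
rewrite mulr_sumr rmorph_sum mulr_suml; apply: eq_bigr => j _.
by rewrite mulrA tA -mulrA tB rmorphM mulrA.
Qed.

Lemma twisted_adj_iter k A : twisted A -> twisted (adj_iter k A).
Proof.
by elim: k => //= k IH /IH tA; apply: twisted_mul => //; apply: twisted_symadj.
Qed.

Lemma twisted_scalar c : twisted c%:M -> D c = c.
Proof.
move=> /(_ ord_max ord_max); rewrite !mxE !eqxx !mulr1n /wraps eqxx expr1 -Zcent.
by move=> E; apply/esym/subr0_eq/Zreg; rewrite mulrBr E subrr.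
Qed.

End Twist.

(** * Degree and leading coefficient of the iterated product *)

Section LeadingCoefficient.

Variables (R : nzRingType).
Implicit Types (p q : {poly R}).

Definition poly_top d (a : R) p := (size p <= d.+1)%N /\ p`_d = a.

Lemma poly_topM d e a b p q :
  poly_top d a p -> poly_top e b q -> poly_top (d + e) (a * b) (p * q).
Proof.
move=> [sp <-] [sq <-]; split.
  apply: leq_trans (size_polyMleq _ _) _.
  by rewrite -subn1 leq_subLR add1n -addnS -addSn leq_add.
have lt_d : (d < (d + e).+1)%N by rewrite ltnS leq_addr.
rewrite coefM (bigD1 (Ordinal lt_d)) //= addKn big1 ?addr0 // => i.
rewrite -val_eqE /= neq_ltn => /orP[lt_id|lt_di].
  rewrite [q`__]nth_default ?mulr0 // (leq_trans sq) //.
  by rewrite ltn_subRL ltn_add2r.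
by rewrite nth_default ?mul0r // (leq_trans sp).
Qed.

Lemma poly_top_sum d (J : Type) (r : seq J) (P : pred J) (a : J -> R) F :
  (forall j, P j -> poly_top d (a j) (F j)) ->
  poly_top d (\sum_(j <- r | P j) a j) (\sum_(j <- r | P j) F j).
Proof.
move=> aF; elim/big_rec2: _ => [|j b p /aF[sF <-] [sp <-]].
  by rewrite /poly_top size_poly0 coef0.
split; last by rewrite coefD.
by rewrite (leq_trans (size_polyD _ _)) // geq_max sF.
Qed.

Lemma poly_top_prod d m (a : 'I_m -> R) F :
  (forall j, poly_top d (a j) (F j)) ->
  poly_top (d * m) (\prod_j a j) (\prod_j F j).
Proof.
elim: m a F => [|m IH] a F aF.
  by rewrite muln0 !big_ord0 /poly_top size_poly1 coef1.
by rewrite mulnS !big_ord_recl; apply: poly_topM => //; apply: IH.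
Qed.

Lemma poly_top_sign (b : bool) : poly_top 0 ((-1) ^+ b) ((-1) ^+ b).
Proof.
case: b; rewrite /poly_top ?expr0 ?expr1 ?size_polyN ?coefN size_poly1 coef1 //.
Qed.

Variable n : nat.
Implicit Types (A B : 'M[{poly R}]_n.+1) (N : 'I_n.+1 -> nat).

(** The degree [d] part is diagonal with natural entries. Their positivity survives the iteration
    and makes the final leading coefficient invertible in characteristic zero. *)
Definition mx_top d N A :=
  forall i j, poly_top d ((i == j) * N i)%:R (A i j).

Lemma mx_topM d e N N' A B : mx_top d N A -> mx_top e N' B ->
  mx_top (d + e) (fun i => N i * N' i)%N (A *m B).
Proof.
move=> tA tB i l; rewrite mxE.
have -> : (((i == l) * (N i * N' i))%:R : R)
    = \sum_j ((i == j) * N i)%:R * ((j == l) * N' j)%:R.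
  rewrite (bigD1 i) //= eqxx mul1n big1 ?addr0 => [|j /negPf ji].
    by rewrite -natrM mulnCA.
  by rewrite eq_sym ji mul0r.
by apply: poly_top_sum => j _; apply: poly_topM.
Qed.

Definition symadj_top N (l : 'I_n.+1) : nat :=
  (\sum_(t : 'S_n.+1 | t ord0 == l) \prod_(q < n) N (t (lift ord0 q)))%N.

Lemma symadj_top_gt0 N l : (forall i, 0 < N i)%N -> (0 < symadj_top N l)%N.
Proof.
move=> N_gt0; rewrite /symadj_top (bigD1 (tperm ord0 l)) ?tpermL //=.
by rewrite addn_gt0 prodn_gt0.
Qed.

(** Only the identity [s] contributes in top degree, since any other [s] picks an off-diagonal
    factor. *)
Lemma mx_top_symadj d N A :
  mx_top d N A -> mx_top (d * n) (symadj_top N) (symadj A).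
Proof.
move=> tA j l; rewrite mxE.
pose a (s t : 'S_n.+1) : R := (-1) ^+ s *
  \prod_(q < n) ((t (lift ord0 q) == s (t (lift ord0 q))) * N (t (lift ord0 q)))%:R.
have -> : (((j == l) * symadj_top N j)%:R : R)
    = \sum_(s : 'S_n.+1 | s l == j) \sum_(t : 'S_n.+1 | t ord0 == l) a s t.
  have a0 (s t : 'S_n.+1) : s != 1%g -> t ord0 == l -> a s t = 0.
    move=> s1 t0.
    (* A permutation fixing every index but [l] also fixes [l]. *)
    have [k kl sk] : exists2 k, k != l & k != s k.
      apply/exists_inP; apply: contraR s1 => /exists_inPn fixs.
      have {}fixs k : k != l -> s k = k by move/fixs; rewrite negbK => /eqP.
      apply/eqP/permP => k; rewrite perm1.
      have [->|/fixs//] := eqVneq k l; apply/eqP; apply: contraT => sl.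
      by have /perm_inj/eqP := fixs _ sl; rewrite (negPf sl).
    have : ord0 != (t^-1)%g k.
      by apply: contraNneq kl => k0; rewrite -(eqP t0) k0 permKV.
    case/unlift_some => q qk _.
    by rewrite /a -natr_prod (bigD1 q) //= -qk permKV (negPf sk) mulr0.
  have [->|jl] := eqVneq j l; last first.
    rewrite big1 // => s slj; rewrite big1 // => t; apply: a0.
    by apply: contraNneq jl => s1; rewrite s1 perm1 eq_sym in slj.
  rewrite (bigD1 1%g) ?perm1 //= [X in _ + X]big1 ?addr0; last first.
    by move=> s /andP[_ s1]; rewrite big1 // => t; apply: a0.
  rewrite mul1n natr_sum; apply: eq_bigr => t _.
  rewrite /a odd_perm1 mul1r natr_prod; apply: eq_bigr => q _.
  by rewrite perm1 eqxx mul1n.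
apply: poly_top_sum => s _; apply: poly_top_sum => t _.
rewrite -[(d * n)%N]add0n; apply: poly_topM; first exact: poly_top_sign.
by apply: poly_top_prod => q; apply: tA.
Qed.

Lemma mx_top_adj_iter k d N A : (forall i, 0 < N i)%N -> mx_top d N A ->
  exists N', (forall i, 0 < N' i)%N /\ mx_top (d * n.+1 ^ k) N' (adj_iter k A).
Proof.
move=> N_gt0 tA; elim: k => [|k [N' [N'_gt0 tk]]]; first by exists N; rewrite muln1.
exists (fun i => N' i * symadj_top N' i)%N; split=> [i|].
  by rewrite muln_gt0 N'_gt0 symadj_top_gt0.
rewrite expnSr mulnA mulnS; apply: mx_topM => //.
exact: mx_top_symadj.
Qed.

End LeadingCoefficient.

(** * From Lie nilpotency of [R] to that of polynomial rings *)

Section LieNilpotence.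

Lemma overcenter_all (R : pzRingType) : overcenter (fun _ : R => True).
Proof. by []. Qed.

Lemma lie_nilpotent_lcs (R : pzRingType) k : lie_nilpotent R k ->
  forall x : R, lcs (fun _ => True) k x -> x = 0.
Proof.
move=> nilR x.
have foldlD : forall (s : seq R) (y z : R),
    foldl (@lie_comm R) (y + z) s = foldl (@lie_comm R) y s + foldl (@lie_comm R) z s.
  by elim=> //= a s IH y z; rewrite lieDl IH.
have foldlZ : forall (s : seq R) (c y : R), central c ->
    foldl (@lie_comm R) (c * y) s = c * foldl (@lie_comm R) y s.
  by elim=> //= a s IH c y cC; rewrite lieZl // IH.
have foldl0 (s : seq R) : foldl (@lie_comm R) 0 s = 0.
  by elim: s => //= a s IH; rewrite lie0l.
(* Generalised for the induction: [s] holds the brackets already peeled off [y]. *)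
suff H i : forall (y : R) (s : seq R), lcs (fun _ => True) i y ->
    (i + size s)%N = k -> foldl (@lie_comm R) y s = 0.
  by move=> Lx; apply: (H k x [::]) => //; rewrite addn0.
elim: i => [|i IH] y s /=; first by move=> _ ks;
  rewrite -[RHS](nilR y (tcast ks (in_tuple s))) val_tcast.
move=> + ks; elim=> {y} [_ [a [b [La _ ->]]]| |y z _ Ly _ Lz|c y cC _ Ly].
- by apply: (IH a (b :: s)) => //=; rewrite addnS.
- exact: foldl0.
- by rewrite foldlD Ly Lz addr0.
- by rewrite foldlZ // Ly mulr0.
Qed.

Lemma central_coef (R : nzRingType) (c : {poly R}) m : central c -> central c`_m.
Proof. by move=> cC x; rewrite -coefMC cC coefCM. Qed.

(** Polynomial variables are central, so a coefficient of a bracket is a sum of brackets of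
    coefficients. *)
Lemma lcs_coef (R : nzRingType) i (p : {poly R}) m :
  lcs (fun _ => True) i p -> lcs (fun _ => True) i p`_m.
Proof.
elim: i p m => //= i IH p m Lp.
elim: Lp m => {p} [_ [a [b [La _ ->]]]| |p q _ Lp _ Lq|c p cC _ Lp] m.
- rewrite coefB coefM coefMr -sumrB; apply: cspan_sum => j _.
  by apply: cspan_gen; exists a`_j, b`_(m - j); split=> //; apply: IH.
- by rewrite coef0; apply: cspan0.
- by rewrite coefD; apply: cspanD.
- rewrite coefM; apply: cspan_sum => j _.
  by apply: cspanZ => //; apply: central_coef.
Qed.

End LieNilpotence.

(** Comparing coefficients of X^m gives p_m = P_(m-1) - A P_m; multiplied on the left by A^m, these
    telescope. Scalars do not commute with [A], so they stay on the right. *)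
Lemma right_Cayley_Hamilton (R : nzRingType) n (A : 'M[R]_n.+1)
    (P : 'M[{poly R}]_n.+1) (p : {poly R}) d :
  ('X%:M - map_mx polyC A) *m P = p%:M -> (size p <= d)%N ->
  \sum_(m < d) A ^+ m *m (p`_m)%:M = 0.
Proof.
move=> AP sp.
pose Pc m := \matrix_(i, j) (P i j)`_m.
have pE m : (p`_m)%:M = (if m is m'.+1 then Pc m' else 0) - A *m Pc m.
  apply/matrixP => i j; have := congr1 (fun B : 'M[{poly R}]_n.+1 => (B i j)`_m) AP.
  rewrite mulmxBl mul_scalar_mx !mxE coefB coefXM coef_sum => E.
  transitivity ((p *+ (i == j))`_m); first by rewrite coefMn.
  rewrite -E; congr (_ - _); first by case: (m) => [|m'] /=; rewrite !mxE.
  by apply: eq_bigr => l _; rewrite !mxE coefCM.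
have tele M : \sum_(m < M.+1) A ^+ m *m (p`_m)%:M = - (A ^+ M.+1 *m Pc M).
  elim: M => [|M IH].
    by rewrite big_ord1 expr0 expr1 mul1mx pE sub0r.
  rewrite big_ord_recr IH /= pE mulmxBr addrA addNr sub0r.
  by rewrite mulmxA (exprSr A M.+1).
(* [M] bounds the sizes of [p] and of all entries of [P], so the telescoped remainder vanishes. *)
pose e := (\sum_i \sum_j size (P i j))%N; pose M := (d + e)%N.
have PM0 : Pc M = 0.
  apply/matrixP => i j; rewrite !mxE nth_default // (leq_trans _ (leq_addl _ _)) //.
  by rewrite /e (bigD1 i) //= (bigD1 j) //= -addnA leq_addr.
have := tele M; rewrite PM0 mulmx0 oppr0 /M -addnS big_split_ord /= [X in _ + X]big1 ?addr0 // => m _.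
rewrite nth_default ?(leq_trans sp) ?leq_addr //.
by rewrite raddf0 mulmx0.
Qed.

(** * The skew polynomials as a free left module over R[w^n] *)

Section SkewDecomposition.

Variables (K : comNzRingType) (R : algType K) (delta : {lrmorphism R -> R}).
Variables (n : nat) (delta_n : forall r, iter n.+1 delta r = r).

Local Notation S := (skewpoly delta).
Local Notation w := (skewX delta).
Local Notation C := (skewC delta).

Lemma skewC_is_zmod : zmod_morphism C.
Proof. by move=> x y; apply: polyCB. Qed.

Lemma skewC_is_monoid : monoid_morphism C.
Proof.
split=> // x y; apply/skew_coefP => i; rewrite skew_coefM big_ord_recl big1 => [|j _].
  by rewrite !skew_coefC subn0 /= addr0; case: eqP => // _; rewrite mulr0.
by rewrite skew_coefC mul0r.
Qed.

HB.instance Definition _ := GRing.isZmodMorphism.Build R S C skewC_is_zmod.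
HB.instance Definition _ := GRing.isMonoidMorphism.Build R S C skewC_is_monoid.

Lemma skewXn_skewC m r : w ^+ m * C r = C (iter m delta r) * w ^+ m.
Proof.
elim: m => [|m IH]; first by rewrite expr0 mul1r mulr1.
by rewrite exprS -mulrA IH mulrA skewX_skewC -mulrA -exprS.
Qed.

Lemma skewXn_central (f : S) : w ^+ n.+1 * f = f * w ^+ n.+1.
Proof.
rewrite (skewpoly_expand f) mulr_sumr mulr_suml; apply: eq_bigr => i _.
by rewrite mulrA skewXn_skewC delta_n -!mulrA -!exprD addnC.
Qed.

Lemma skewXn_comm : commr_rmorph C (w ^+ n.+1).
Proof. by move=> r; rewrite /GRing.comm skewXn_central. Qed.

Definition inXn : {poly R} -> S := horner_morph skewXn_comm.
HB.instance Definition _ := GRing.RMorphism.on inXn.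

Lemma inXnE p : inXn p = \sum_(i < size p) C p`_i * w ^+ (n.+1 * i).
Proof.
by rewrite /inXn /horner_morph horner_poly; apply: eq_bigr => i _; rewrite exprM.
Qed.

Lemma inXnX : inXn 'X = w ^+ n.+1.
Proof. exact: horner_morphX. Qed.

Lemma skew_coef_inXn p (j : 'I_n.+1) l :
  skew_coef (inXn p * w ^+ j) l
  = if l == (l %/ n.+1 * n.+1 + j)%N then p`_(l %/ n.+1) else 0.
Proof.
rewrite inXnE mulr_suml skew_coef_sum.
under eq_bigr do rewrite -mulrA -exprD skew_coefCXn.
case: eqP => [lE|l_ne]; last first.
  rewrite big1 // => i _; case: eqP => // lE; case: l_ne; rewrite {1}lE.
  by rewrite lE mulnC divnMDl // divn_small // addn0.
rewrite {1}lE; under eq_bigr do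
  rewrite eqn_add2r mulnC eqn_pmul2l //.
have [lt_q|le_q] := ltnP (l %/ n.+1) (size p).
  rewrite (bigD1 (Ordinal lt_q)) //= eqxx big1 ?addr0 // => i.
  by rewrite -val_eqE /= eq_sym => /negPf ->.
rewrite nth_default // big1 // => i _; case: eqP => // qi.
by move: (ltn_ord i); rewrite -qi ltnNge le_q.
Qed.

Definition skew_part (g : S) (j : 'I_n.+1) : {poly R} :=
  \poly_(m < size (g : {poly R})) skew_coef g (m * n.+1 + j).

Lemma skew_coef_sum_inXn (p : 'I_n.+1 -> {poly R}) m (j : 'I_n.+1) :
  skew_coef (\sum_l inXn (p l) * w ^+ l) (m * n.+1 + j) = (p j)`_m.
Proof.
rewrite skew_coef_sum (bigD1 j) //= skew_coef_inXn divnMDl // divn_small //.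
rewrite addn0 eqxx big1 ?addr0 // => l; rewrite -val_eqE /= => lj.
rewrite skew_coef_inXn divnMDl // divn_small // addn0 eqn_add2l eq_sym.
by rewrite (negPf lj).
Qed.

Lemma skew_part_expand g : g = \sum_j inXn (skew_part g j) * w ^+ j.
Proof.
apply/skew_coefP => l; have lt_r := ltn_pmod l (ltn0Sn n).
rewrite (divn_eq l n.+1) (skew_coef_sum_inXn _ _ (Ordinal lt_r)) coef_poly /=.
case: ltnP => // le_s; rewrite /skew_coef nth_default //.
by apply: leq_trans le_s (leq_trans _ (leq_addr _ _)); apply: leq_pmulr.
Qed.

Lemma inXn_inj (p q : 'I_n.+1 -> {poly R}) :
  \sum_j inXn (p j) * w ^+ j = \sum_j inXn (q j) * w ^+ j -> p =1 q.
Proof.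
move=> pq j; apply/polyP => m.
by rewrite -(skew_coef_sum_inXn p) pq skew_coef_sum_inXn.
Qed.

Lemma skewX_inXn p : w * inXn p = inXn (map_poly delta p) * w.
Proof.
elim/poly_ind: p => [|p c IH]; first by rewrite !raddf0 mulr0 mul0r.
rewrite !rmorphD !rmorphM /= map_polyX map_polyC /= inXnX.
rewrite mulrDr mulrDl mulrA IH -!mulrA -skewXn_central; congr (_ + _).
by rewrite /inXn !horner_morphC skewX_skewC.
Qed.

Lemma skewXn_inXn_fixed m p : map_poly delta p = p -> GRing.comm (w ^+ m) (inXn p).
Proof.
by move=> fp; apply/commr_sym/commrX/commr_sym; rewrite /GRing.comm skewX_inXn fp.
Qed.

Lemma inXn_fixed p : map_poly delta p = p -> inXn p \in fix_skewpoly delta n.+1.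
Proof.
move=> fp; apply/fix_skewpoly_coefP => i.
have := skew_coef_inXn p ord0 i; rewrite mulr1 addn0 => ->.
split=> [|ni]; last by case: eqP => // iE; rewrite iE dvdn_mull in ni.
by case: eqP => _; rewrite ?raddf0 // -[in RHS]fp coef_map.
Qed.

(** Right multiplication with left coordinates makes coefficients accumulate in the order of matrix
    products, so powers of [f] go to powers of the matrix. *)
Definition rmul_mx (f : S) : 'M[{poly R}]_n.+1 :=
  \matrix_(i, j) skew_part (w ^+ i * f) j.

Lemma rmul_mxE f (i : 'I_n.+1) : w ^+ i * f = \sum_j inXn (rmul_mx f i j) * w ^+ j.
Proof. by rewrite [LHS]skew_part_expand; apply: eq_bigr => j _; rewrite mxE. Qed.

Lemma rmul_mxX f m (i : 'I_n.+1) :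
  w ^+ i * f ^+ m = \sum_j inXn ((rmul_mx f ^+ m) i j) * w ^+ j.
Proof.
elim: m => [|m IH].
  rewrite expr0 mulr1 (bigD1 i) //= big1 ?addr0 => [|j ij].
    by rewrite expr0 mxE eqxx rmorph1 mul1r.
  by rewrite expr0 mxE eq_sym (negPf ij) raddf0 mul0r.
rewrite exprSr mulrA IH mulr_suml.
under eq_bigr do rewrite -mulrA rmul_mxE mulr_sumr.
rewrite exchange_big; apply: eq_bigr => j _.
rewrite exprSr mxE rmorph_sum mulr_suml; apply: eq_bigr => l _.
by rewrite rmorphM mulrA.
Qed.

Lemma skewX_wrap (i : 'I_n.+1) :
  w ^+ i.+1 = inXn ('X ^+ wraps i) * w ^+ cyc n i.
Proof.
rewrite rmorphXn /= inXnX /wraps permE /=.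
have [->|i_max] := eqVneq i ord_max.
  by rewrite modnn mulr1.
rewrite mul1r modn_small // ltnS ltn_neqAle -ltnS ltn_ord andbT.
exact: i_max.
Qed.

(** Expand w^(i+1) f as (w^(i+1)) f and as w (w^i f), and compare coordinates. *)
Lemma rmul_mx_twisted f (i j : 'I_n.+1) :
  'X ^+ wraps i * rmul_mx f (cyc n i) (cyc n j)
  = map_poly delta (rmul_mx f i j) * 'X ^+ wraps j.
Proof.
have := @inXn_inj
  (fun l => 'X ^+ wraps i * rmul_mx f (cyc n i) l)
  (fun l => map_poly delta (rmul_mx f i ((cyc n)^-1%g l)) * 'X ^+ wraps ((cyc n)^-1%g l)).
move=> /(_ _ (cyc n j)); rewrite permK; apply.
transitivity (w ^+ i.+1 * f).
  rewrite skewX_wrap -mulrA rmul_mxE mulr_sumr.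
  by apply: eq_bigr => l _; rewrite rmorphM mulrA.
rewrite exprS -mulrA rmul_mxE mulr_sumr [RHS](reindex_inj (@perm_inj _ (cyc n))) /=.
apply: eq_bigr => l _.
by rewrite permK mulrA skewX_inXn -mulrA -exprS skewX_wrap mulrA rmorphM.
Qed.

End SkewDecomposition.

(** * The monic equation for [f] *)

Lemma skewpoly_right_integral (K : fieldType) (charK : [pchar K] =i pred0)
    (k : nat) (R : algType K) (R_nil : lie_nilpotent R k.+1)
    (n : nat) (delta : {lrmorphism R -> R})
    (delta_n : forall r : R, iter n.+1 delta r = r) :
  right_integral_of_degree (fix_skewpoly delta n.+1) (n.+1 ^ k.+1).
Proof.
move=> f; pose Q := {poly {poly R}}.
have [A AE] : exists A, A = rmul_mx n f by exists (rmul_mx n f).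
pose XA : 'M[Q]_n.+1 := 'X%:M - map_mx polyC A.
have natK m : m.+1%:R != 0 :> K by have /pcharf0P -> := charK.
have natV m : exists d : Q, m.+1%:R * d = 1.
  exists ((m.+1%:R^-1)%:A%:P%:P); rewrite -!polyC_natr -!rmorphM /=.
  by rewrite mulr_natl -scaler_nat scalerA mulfV // scale1r.
have nilQ (x : Q) : lcs (fun _ => True) k.+1 x -> x = 0.
  move=> Lx; apply/polyP => i; apply/polyP => j; rewrite !coef0.
  by apply: (lie_nilpotent_lcs R_nil); apply/lcs_coef/lcs_coef.
have [c cE] := adj_iter_scalar natV (overcenter_all Q) nilQ (A := XA) (fun _ _ => I).
have [N' [N'_gt0 /(_ ord0 ord0)]] :
    exists N', (forall i, 0 < N' i)%N /\
      mx_top (1 * n.+1 ^ k.+1) N' (adj_iter k.+1 XA).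
  apply: (@mx_top_adj_iter _ _ _ _ (fun _ => 1%N)) => // i j.
  rewrite muln1 !mxE; split.
    rewrite (leq_trans (size_polyD _ _)) // geq_max size_polyN.
    rewrite (leq_trans (size_polyC_leq1 _)) // andbT.
    by case: eqP; rewrite ?size_polyX ?size_poly0.
  by rewrite coefB coefC subr0; case: eqP; rewrite ?coefX ?coef0.
rewrite cE !mxE eqxx mul1n mulr1n mul1n => -[sc c_top].
have [P XAP] := adj_iter_mul k.+1 XA; rewrite cE in XAP.
have c_fix m : map_poly delta c`_m = c`_m.
  (* The inner variable, standing for w^n; the outer one belongs to the characteristic matrix. *)
  pose Z : Q := 'X%:P.
  have Zcent : central Z.
    by move=> x; apply/polyP => i; rewrite coefCM coefMC; apply/esym/commr_polyX.
  have Zreg x : Z * x = 0 -> x = 0.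
    move=> Zx0; apply/polyP => i; have := congr1 (fun p : Q => p`_i) Zx0.
    rewrite coefCM !coef0 => Xx0; apply/polyP => j.
    by have := congr1 (fun p : {poly R} => p`_j.+1) Xx0; rewrite coefXM !coef0.
  have tXA : twisted (map_poly (map_poly delta)) Z XA.
    move=> i j; rewrite !mxE (inj_eq perm_inj) mulrBr rmorphB mulrBl.
    congr (_ - _); last first.
      by rewrite -!rmorphXn /= map_polyC -!rmorphM /= AE (rmul_mx_twisted delta_n).
    case: eqP => [->|_]; last by rewrite !mulr0n raddf0 mulr0 mul0r.
    by rewrite !mulr1n /= map_polyX (central_exp Zcent).
  have := twisted_adj_iter Zcent Zreg k.+1 tXA.
  rewrite cE => /(twisted_scalar Zcent Zreg) E.
  by rewrite -[in RHS]E coef_map.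
have CH := right_Cayley_Hamilton (esym XAP) sc.
(* Row 0 of the matrix identity, since w^0 = 1. The coefficients are fixed by [delta], so they
   commute with w^j and can be moved to the right of it. *)
have root_f : \sum_(m < (n.+1 ^ k.+1).+1) f ^+ m * inXn delta_n c`_m = 0.
  transitivity (\sum_(m < (n.+1 ^ k.+1).+1)
      \sum_j inXn delta_n ((A ^+ m *m (c`_m)%:M) ord0 j) * skewX delta ^+ j).
    apply: eq_bigr => m _; have := rmul_mxX delta_n f m ord0; rewrite mul1r -AE => ->.
    rewrite mulr_suml; apply: eq_bigr => j _.
    rewrite -mulrA (skewXn_inXn_fixed delta_n _ (c_fix m)) mulrA -rmorphM.
    rewrite mxE (bigD1 j) //= mxE eqxx mulr1n big1 ?addr0 // => l /negPf lj.
    by rewrite mxE lj mulr0.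
  rewrite exchange_big big1 // => j _; rewrite -mulr_suml -rmorph_sum.
  by rewrite -summxE CH mxE raddf0 mul0r.
(* Dividing by the leading coefficient, a positive integer, makes the equation monic. *)
exists (fun m => (N' ord0)%:R^-1 *: inXn delta_n c`_m).
split=> [i|]; first by apply: rpredZ; apply: inXn_fixed; apply: c_fix.
move: root_f; rewrite big_ord_recr /= c_top rmorph_nat => E.
have N'K : (N' ord0)%:R != 0 :> K by case: (N' ord0) (N'_gt0 ord0).
have := congr1 (fun x => (N' ord0)%:R^-1 *: x) E.
rewrite scalerDr scaler0 mulr_natr -scaler_nat scalerA mulVf // scale1r.
rewrite scaler_sumr => E'; rewrite -[RHS]E'; congr (_ + _).
by apply: eq_bigr => i _; rewrite scalerAr.
Qed.

Theorem mainTheorem2 (K : fieldType) (charK : [pchar K] =i pred0)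
  (k : nat) (k_ge1 : (1 <= k)%N)
  (R : algType K) (R_nil : lie_nilpotent R k)
  (n : nat) (e : K) (e_prim : n.-primitive_root e)
  (delta : {lrmorphism R -> R}) (delta_bij : bijective delta)
  (delta_n : forall r : R, iter n delta r = r) :
  (forall f : skewpoly delta, skewX delta ^+ n * f = f * skewX delta ^+ n) /\
  right_integral_of_degree (fix_skewpoly delta n) (n ^ k).
Proof.
(* The order of a primitive root of unity is positive. *)
case: n e_prim delta_n => [/prim_order_gt0//|n _ delta_n].
case: k k_ge1 R_nil => // k _ R_nil.
by split; [exact: skewXn_central|exact: skewpoly_right_integral].
Qed.
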